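(* Let $G$ be a tree on $n$ nodes whose nodes are coloured with only two colours. Then we can build an index of $O(n^2)$ space with which, given a multiset $M$ of the two colours (as its Parikh vector), we can find a match of $M$ in $G$ (if one exists) in $O(|M|)$ time.
   Context: A match of a multiset $M$ of colours in a coloured graph $G$ is a connected subgraph of $G$ whose nodes' colours form exactly the multiset $M$. The Parikh vector of $M$ is the vector of frequencies of each colour in $M$. An index is a data structure built from $G$ used to answer queries. The model of computation is the word-RAM with $\Omega(\log n)$-bit words, and space is measured in words. *)

(* Defs.v *)
From mathcomp Require Import all_boot.
Set Implicit Arguments. Unset Strict Implicit. Unset Printing Implicit Defensive.

(* A (finite simple) tree on the nodes 'I_n : n > 0, the adjacency relation is
   symmetric and irreflexive, the graph is connected and has exactly n-1 edges
   (each undirected edge is counted twice as an ordered pair). *)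
Definition is_tree (n : nat) (e : rel 'I_n) : Prop :=
  [/\ 0 < n,
      symmetric e,
      irreflexive e,
      (forall x y : 'I_n, connect e x y) &
      #|[set p : 'I_n * 'I_n | e p.1 p.2]| = (n - 1).*2].

Definition connected_in (n : nat) (e : rel 'I_n) (S : {set 'I_n}) : Prop :=
  forall x y, x \in S -> y \in S ->
    connect (fun u v => [&& u \in S, v \in S & e u v]) x y.

(* Two colours, encoded as bool.  The multiset M is given by its Parikh vector
   (a, b): a = number of nodes of colour [false], b = number of colour [true].
   S is a match of M: a connected subgraph whose colours form exactly M. *)
Definition is_match (n : nat) (e : rel 'I_n) (col : 'I_n -> bool)
    (S : {set 'I_n}) (a b : nat) : Prop :=
  [/\ connected_in e S,
      #|[set x in S | ~~ col x]| = a &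
      #|[set x in S | col x]| = b].

Inductive binop :=
  | OAdd | OSub | OMul | ODiv | OMod | OLt | OEq
  | OAnd | OOr | OXor | OShl | OShr.

Definition eval_binop (op : binop) (x y : nat) : nat :=
  match op with
  | OAdd => x + y
  | OSub => x - y
  | OMul => x * y
  | ODiv => x %/ y
  | OMod => x %% y
  | OLt => (x < y : nat)
  | OEq => ((x == y) : nat)
  | OAnd => Nat.land x y
  | OOr => Nat.lor x y
  | OXor => Nat.lxor x y
  | OShl => x * 2 ^ y
  | OShr => x %/ 2 ^ y
  end.

(* Registers are indexed by nat (a fixed program only uses constantly many);
   each register and memory cell holds a w-bit word. *)
Inductive instr :=
  | IConst of nat & nat
  | IBin of binop & nat & nat & nat
  | ILoad of nat & nat
  | IStore of nat & nat
  | IJz of nat & nat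
  | IJmp of nat
  | IOut of nat
  | IHalt.

Record state := State {
  pc : nat;
  regs : nat -> nat;
  mem : nat -> nat;
  outrev : seq nat }.

Definition upd (f : nat -> nat) (i v : nat) : nat -> nat :=
  fun j => if j == i then v else f j.

Definition step (P : seq instr) (w : nat) (st : state) : option state :=
  let: State p r m o := st in
  let W := 2 ^ w in
  if p < size P then
    match nth IHalt P p with
    | IConst d k => Some (State p.+1 (upd r d (k %% W)) m o)
    | IBin op d s t => Some (State p.+1 (upd r d (eval_binop op (r s) (r t) %% W)) m o)
    | ILoad d s => Some (State p.+1 (upd r d (m (r s))) m o)
    | IStore d s => Some (State p.+1 r (upd m (r d) (r s)) o)
    | IJz s l => Some (State (if r s == 0 then l else p.+1) r m o)
    | IJmp l => Some (State l r m o)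
    | IOut s => Some (State p.+1 r m (r s :: o))
    | IHalt => None
    end
  else None.

(* run P w fuel st = Some out  iff the machine halts after executing fewer
   than [fuel] instructions, producing output [out]. *)
Fixpoint run (P : seq instr) (w : nat) (fuel : nat) (st : state) : option (seq nat) :=
  match fuel with
  | 0 => None
  | f.+1 => match step P w st with
            | None => Some (rev (outrev st))
            | Some st' => run P w f st'
            end
  end.

(* Initial state for a query: the Parikh vector (a, b) in registers 0 and 1,
   all other registers 0, memory m0 (which contains the index). *)
Definition init_state (a b : nat) (m0 : nat -> nat) : state :=
  State 0 (upd (upd (fun _ => 0) 0 a) 1 b) m0 [::].

Definition correct_output (n : nat) (e : rel 'I_n) (col : 'I_n -> bool)
    (a b : nat) (out : seq nat) : Prop :=
  ((exists S : {set 'I_n}, is_match e col S a b) ->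
     exists s, [/\ out = 1 :: s, uniq s, all (fun i => i < n) s &
                   is_match e col [set x : 'I_n | val x \in s] a b]) /\
  (~ (exists S : {set 'I_n}, is_match e col S a b) -> out = [:: 0]).

(* Main.v *)
(** For each size [k], join a closed tour of a connected [k]-set with as few [true] nodes
    as possible, a path, and a tour of a connected [k]-set with as many [true] nodes as
    possible into one walk of length O(n).  Every window of a walk spans a connected
    set.  Sliding a window with exactly [k] distinct nodes along the walk changes its
    number of [true] nodes by at most one per step, so every feasible Parikh vector of
    size [k] occurs in some window, and such a window has length O(k) because a tour of
    a [k]-set has length O(k) and the path is simple.  The index stores these walks (O(n^2)
    words in total) and, for each Parikh vector, the two ends of a window.  Next to
    each entry it stores the address of the previous occurrence of the same node, so that
    a query scans its window and outputs a node exactly when its previous occurrence lies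
    before the window; no working memory is needed. *)

Require Import Defs.
From mathcomp Require Import all_boot.
From mathcomp Require Import zify.
From Stdlib Require Import Classical ClassicalEpsilon.
Set Implicit Arguments. Unset Strict Implicit. Unset Printing Implicit Defensive.

(** * Windows with a fixed number of distinct nodes *)

Lemma subseq_cat_split (T : eqType) (U A B : seq T) :
  subseq U (A ++ B) ->
  exists U1 U2, [/\ U = U1 ++ U2, subseq U1 A & subseq U2 B].
Proof.
case/subseqP=> m sz_m ->; exists (mask (take (size A) m) A), (mask (drop (size A) m) B).
split; rewrite ?mask_subseq // -mask_cat ?cat_take_drop //.
by rewrite size_takel // sz_m size_cat leq_addr.
Qed.

Section Windows.
Variables (T : finType) (col : T -> bool).
Implicit Types (s U P Q A : seq T) (x y : T) (k b : nat).

Definition distinct s := #|[set x in s]|.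
Definition trues s := #|[set x in s | col x]|.

Lemma set_cons x s : [set y in x :: s] = x |: [set y in s].
Proof. by apply/setP=> y; rewrite !inE. Qed.

Lemma distinct_cons x s : distinct (x :: s) = (x \notin s) + distinct s.
Proof. by rewrite /distinct set_cons cardsU1 inE. Qed.

Lemma trues_set s s' : [set x in s] = [set x in s'] -> trues s = trues s'.
Proof.
move=> E; rewrite /trues; apply: eq_card => x.
by move/setP/(_ x): E; rewrite !inE => ->.
Qed.

Lemma trues_setU1 y s s' :
  y \notin s' -> [set x in s] = y |: [set x in s'] -> trues s = col y + trues s'.
Proof.
move=> ys E; rewrite /trues.
have mem_s x : (x \in s) = (x == y) || (x \in s').
  by move/setP/(_ x): E; rewrite !inE.
case cy: (col y); last first.
  apply: eq_card => x; rewrite !inE mem_s.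
  by case: (eqVneq x y) => [->|_] //; rewrite cy !andbF.
rewrite -[X in _ = X + _](_ : (y \notin [set x in s' | col x]) = true :> nat); last first.
  by rewrite !inE (negbTE ys).
rewrite -cardsU1; apply: eq_card => x; rewrite !inE mem_s.
by case: (eqVneq x y) => [->|_] //; rewrite cy.
Qed.

(** Entries are dropped from the end: a repeat leaves the set unchanged, and the first dropped entry
    without an earlier occurrence is [y]. *)
Lemma trim_window k Q : distinct Q = k.+1 ->
  exists Q' y, [/\ prefix Q' Q, distinct Q' = k, y \notin Q' &
                   [set x in Q] = y |: [set x in Q']].
Proof.
elim/last_ind: Q => [|Q z IH].
  by rewrite /distinct (_ : [set x in [::]] = set0) ?cards0 //; apply/setP=> x; rewrite !inE.
have E : [set x in rcons Q z] = z |: [set x in Q].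
  by apply/setP=> x; rewrite !inE mem_rcons inE.
rewrite /distinct E cardsU1 inE; case zQ: (z \in Q) => /=.
  rewrite add0n => /IH[Q' [y [pQ dQ yQ EQ]]]; exists Q', y; split=> //.
    by apply: prefix_trans pQ _; apply: prefix_rcons.
  by rewrite -EQ; apply/setUidPr; rewrite sub1set inE.
case=> dQ; exists Q, z; split=> //; [exact: prefix_rcons | by rewrite zQ].
Qed.

(* A window with [k] distinct nodes is extended by one node at its front and then shortened
   at its back until it has [k] distinct nodes again: at most one node enters and at most
   one leaves. *)
Lemma slide_window k x P : distinct P = k ->
  exists P', [/\ prefix P' (x :: P), distinct P' = k & trues P <= (trues P').+1].
Proof.
move=> dP; case xP: (x \in P).
  have E : [set y in x :: P] = [set y in P].
    by rewrite set_cons; apply/setUidPr; rewrite sub1set inE.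
  exists (x :: P); split; [exact: prefix_refl | by rewrite /distinct E |].
  by rewrite (trues_set E).
have: distinct (x :: P) = k.+1 by rewrite distinct_cons xP dP.
case/trim_window=> Q [y [pQ dQ yQ EQ]]; exists Q; split=> //.
have /(trues_setU1 (negbT xP)) := set_cons x P.
rewrite (trues_setU1 yQ EQ); lia.
Qed.

(** Discrete intermediate value argument: the entries of [A] are prepended one at a time and the
    window slides from [Q] to the front. As the count drops by at most one per step, no value in
    between is skipped. The final window [P] is a prefix, so [prefix_same_set] can identify its
    nodes. *)
Lemma window_ivt k A Q : distinct Q = k ->
  exists P, [/\ prefix P (A ++ Q), distinct P = k &
    forall b, trues P <= b <= trues Q ->
      exists U, [/\ infix U (A ++ Q), distinct U = k & trues U = b]].
Proof.
move=> dQ; elim: A => [|x A [P [pP dP IH]]].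
  exists Q; split=> //; first exact: prefix_refl.
  move=> b bQ; exists Q; split=> //; [exact: infix_refl | lia].
have [P' [pP' dP' le_P]] := slide_window x dP.
have pP'x : prefix P' (x :: A ++ Q).
  by apply: prefix_trans pP' _; rewrite prefix_cons eqxx.
exists P'; split=> // b bP'.
case: (leqP (trues P) b) => Pb.
  have [|U [iU dU tU]] := IH b; first lia.
  by exists U; split=> //; apply: infix_trans iU _; apply: infix_cons.
exists P'; split=> //; [exact: prefixW | lia].
Qed.

(** Prefixes of one sequence are nested, and nested sets of equal cardinality coincide. *)
Lemma prefix_same_set P P' Q : prefix P Q -> prefix P' Q ->
  distinct P = distinct P' -> [set x in P] = [set x in P'].
Proof.
wlog le_s : P P' / size P <= size P'.
  move=> W pP pP' d; case/orP: (leq_total (size P) (size P')) => ss; first exact: W.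
  by apply/esym/W.
move=> /prefixP[R ->] /prefixP[R' E] d; apply/eqP.
rewrite eqEcard -/(distinct P) -/(distinct P') d leqnn andbT.
apply/subsetP=> x; rewrite !inE => xP.
have -> : P' = P ++ take (size P' - size P) R.
  by rewrite -[LHS](take_size_cat R' erefl) -E take_cat ltnNge le_s.
by rewrite mem_cat xP.
Qed.

End Windows.

(** * Walks, tours and the windows covering all matches *)

Section Walks.
Variables (n : nat) (e : rel 'I_n).
Hypotheses (sym_e : symmetric e) (conn_e : forall x y, connect e x y).

(* Steps that stay put let two walks be concatenated at a common end. *)
Definition stay_or_step : rel 'I_n := fun u v => (u == v) || e u v.

Lemma walk_connected (U : seq 'I_n) :
  sorted stay_or_step U -> connected_in e [set x in U].
Proof.
case: U => [|x p] /=; first by move=> _ y z; rewrite inE.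
set S := [set _ in _] => pth.
pose R := fun u v => [&& u \in S, v \in S & e u v].
have sym_R : symmetric R by move=> u v; rewrite /R sym_e andbCA.
have connect_sym_R := sym_connect_sym sym_R.
suff from_x y : y \in x :: p -> connect R x y.
  move=> y z; rewrite !inE => /from_x xy /from_x xz.
  by apply: connect_trans xz; rewrite -/R connect_sym_R.
have subS : {subset x :: p <= S} by move=> z zp; rewrite /S inE.
move: pth subS y; rewrite -/R; elim: (p) {1 2 3 4}(x) => [|z q IH] u /=.
  by move=> _ _ y; rewrite inE => /eqP->.
case/andP=> uz pth sub y; rewrite inE => /orP[/eqP->//|yq].
have Ruz : connect R u z.
  case/orP: uz => [/eqP->//|uz]; apply: connect1.
  by rewrite /R uz !sub ?inE ?eqxx ?orbT.
apply: connect_trans Ruz _; apply: IH => // t tq; apply: sub.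
by rewrite inE tq orbT.
Qed.

(** A path inside [S] from a node of [R] to a node outside [R] has to cross the boundary of [R]. *)
Lemma leaving_edge (S R : {set 'I_n}) :
  connected_in e S -> R \subset S -> R != set0 -> R != S ->
  exists u v, [/\ u \in R, v \in S, v \notin R & e u v].
Proof.
move=> cS RS /set0Pn[x xR] neqRS.
have /subsetPn[y yS yR] : ~~ (S \subset R).
  by apply: contra neqRS => SR; rewrite eqEsubset RS.
case: (pickP [pred p : 'I_n * 'I_n | [&& p.1 \in R, p.2 \in S, p.2 \notin R & e p.1 p.2]]).
  by case=> u v /= /and4P[]; exists u, v.
move=> no; have /connectP[p pth Ey] := cS x y (subsetP RS _ xR) yS.
case/negP: yR; rewrite Ey {Ey}; elim: p x xR pth => //= z p IH x xR /andP[/and3P[_ zS xz]].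
apply: IH; have := no (x, z); rewrite /= xR zS xz /= andbT => /negbFE; exact.
Qed.

(** The walk gains one node at a time: an edge from a visited [u] to a new [v] is spliced in as the
    detour [u v u], which adds two entries. *)
Lemma tour (S : {set 'I_n}) k :
  connected_in e S -> #|S| = k.+1 ->
  exists x p, [/\ path e x p, [set y in x :: p] = S & size p = k.*2].
Proof.
move=> cS cardS.
suff grow j : j <= k -> exists x p, [/\ path e x p, [set y in x :: p] \subset S,
    #|[set y in x :: p]| = j.+1 & size p = j.*2].
  have [x [p [pth sub card sz]]] := grow k (leqnn k).
  by exists x, p; split=> //; apply/eqP; rewrite eqEcard sub card cardS leqnn.
elim: j => [_|j IH lt_jk].
  have /set0Pn[x xS] : S != set0 by rewrite -card_gt0 cardS.
  have Ex : [set y in [:: x]] = [set x] by apply/setP=> y; rewrite !inE.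
  by exists x, [::]; split=> //; rewrite Ex ?sub1set ?cards1.
have [x [p [pth sub card sz]]] := IH (ltnW lt_jk).
have [||u [v [uR vS vR uv]]] := leaving_edge cS sub.
- by rewrite -card_gt0 card.
- apply: contraTneq lt_jk => ER; rewrite -ltnNge; move: card; rewrite ER cardS; lia.
have [p1 [p2 [Ep El]]] : exists p1 p2, p = p1 ++ p2 /\ last x p1 = u.
  by move: uR; rewrite inE => /splitPl[p1 p2 <-]; exists p1, p2.
exists x, (p1 ++ [:: v, u & p2]).
have E : [set y in x :: p1 ++ [:: v, u & p2]] = v |: [set y in x :: p].
  apply/setP=> y; rewrite !inE !mem_cat !inE.
  have uin : (u == x) || (u \in p1) by rewrite -El -in_cons mem_last.
  rewrite Ep mem_cat; case: (eqVneq y u) => [->|_]; last first.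
    by rewrite orFb; do !case: (_ \in _); do ?case: (_ == _).
  by move: uin; case: (u == x) => [_|] /=; [rewrite !orbT | move=> ->; rewrite !orbT].
split.
- move: pth; rewrite Ep !cat_path El /= => /andP[-> ->].
  by rewrite uv sym_e uv.
- by rewrite E subUset sub1set vS.
- by rewrite E cardsU1 vR card.
- by rewrite size_cat /= doubleS -sz Ep size_cat !addnS.
Qed.

Lemma card_split (col : 'I_n -> bool) (S : {set 'I_n}) :
  #|[set x in S | ~~ col x]| + #|[set x in S | col x]| = #|S|.
Proof.
rewrite addnC -(cardsID [set x | col x] S); congr (_ + _); apply: eq_card => x.
  by rewrite !inE.
by rewrite !inE andbC.
Qed.

(** Boolean form, so that extremal connected sets can be selected by finite search. *)
Definition connectedb (S : {set 'I_n}) :=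
  [forall x in S, forall y in S,
     connect (fun u v => [&& u \in S, v \in S & e u v]) x y].

Lemma connectedP S : reflect (connected_in e S) (connectedb S).
Proof.
apply: (iffP forall_inP) => [H x y xS yS | H x xS].
  by move/forall_inP: (H x xS); apply.
by apply/forall_inP => y yS; apply: H.
Qed.

Lemma windows_of_size (col : 'I_n -> bool) k :
  exists W : seq 'I_n, size W <= 5 * n /\
    forall S a b, a + b = k.+1 -> is_match e col S a b ->
      exists U, [/\ infix U W, size U <= 5 * (a + b) & is_match e col [set x in U] a b].
Proof.
pose ok S := connectedb S && (#|S| == k.+1).
case: (pickP ok) => [S ok_S|none]; last first.
  exists [::]; split=> // S a b ab [cS Sa Sb]; case/negP: (negbT (none S)).
  by rewrite /ok -(card_split col) Sa Sb ab eqxx andbT; apply/connectedP.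
pose cnt (S : {set 'I_n}) := #|[set x in S | col x]|.
case: (@arg_minnP _ S ok cnt ok_S) => S0 /andP[/connectedP c0 /eqP k0] min0.
case: (@arg_maxnP _ S ok cnt ok_S) => S1 /andP[/connectedP c1 /eqP k1] max1.
have [x0 [p0 [pth0 ES0 sz0]]] := tour c0 k0.
have [x1 [p1 [pth1 ES1 sz1]]] := tour c1 k1.
have [q [pthq uniq_q Eq]] : exists q : seq 'I_n,
    [/\ path e (last x0 p0) q, uniq q & x1 = last (last x0 p0) q].
  have /connectP[q0 pthq0 Eq] := conn_e (last x0 p0) x1.
  by move: Eq; case/shortenP: pthq0 => q pthq /= /andP[_ uniq_q] _ Eq; exists q.
have szq : size q <= n by rewrite -[X in _ <= X](card_ord n) -(card_uniqP uniq_q) max_card.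
have le_kn : k < n by rewrite -k0 -[X in _ <= X](card_ord n) max_card.
pose T0 := x0 :: p0; pose T1 := x1 :: p1.
have sub_e : subrel e stay_or_step by move=> u v uv; rewrite /stay_or_step uv orbT.
(* [T0 ++ q] already ends at [x1], the head of [T1]; this repetition is the one stay step. *)
have walkW : sorted stay_or_step ((T0 ++ q) ++ T1).
  rewrite /= cat_path cat_path last_cat -Eq /= /stay_or_step eqxx /=.
  by rewrite !(sub_path sub_e).
have d1 : distinct T1 = k.+1 by rewrite /distinct ES1.
have d0 : distinct T0 = k.+1 by rewrite /distinct ES0.
exists ((T0 ++ q) ++ T1); split.
  (* Two tours of [k.*2.+1] entries and a path of at most [n], where [k < n]. *)
  rewrite !size_cat /= sz0 sz1; lia.
move=> S' a b ab [cS' Sa Sb].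
have [P [pP dP ivt]] := window_ivt col (T0 ++ q) d1.
have EP : [set x in P] = S0.
  rewrite -ES0; apply: (prefix_same_set pP); last by rewrite dP d0.
  by rewrite -catA; apply: prefix_prefix.
have ok_S' : ok S' by rewrite /ok -(card_split col) Sa Sb ab eqxx andbT; apply/connectedP.
have trP : trues col P = cnt S0.
  by rewrite /cnt -EP; apply: eq_card => x; rewrite !inE.
have trT1 : trues col T1 = cnt S1.
  by rewrite /cnt -ES1; apply: eq_card => x; rewrite !inE.
have [|U [iU dU tU]] := ivt b.
  by rewrite trP trT1 -Sb; apply/andP; split; [exact: min0 | exact: max1].
have tU' : #|[set x in [set x in U] | col x]| = b.
  by rewrite -tU; apply: eq_card => x; rewrite !inE.
exists U; split=> //.
(* The window splits into a part of each tour and a part of the simple path. The path part has no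
   repeats, hence at most [k.+1] entries; in total [2 * (2 * k + 1) + k.+1 <= 5 * k.+1]. *)
- have sU := infixW iU.
  have [U1 [U2 [EU sU1 sU2]]] := subseq_cat_split sU.
  have [U3 [U4 [EU1 sU3 sU4]]] := subseq_cat_split sU1.
  have uU4 : uniq U4 := subseq_uniq sU4 uniq_q.
  have szU4 : size U4 <= k.+1.
    rewrite -dU -(card_uniqP uU4); apply: subset_leq_card; apply/subsetP=> x xU4.
    by rewrite inE EU EU1 !mem_cat xU4 orbT.
  have := leq_add (leq_add (size_subseq sU3) szU4) (size_subseq sU2).
  rewrite EU EU1 !size_cat /= sz0 sz1 ab => le_sz.
  by apply: leq_trans le_sz _; clear; lia.
- split=> //.
    apply: walk_connected; case/infixP: iU => A [B EW]; move: walkW; rewrite EW.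
    by case/cat_sorted2=> _ /cat_sorted2[].
  by apply: (@addIn b); rewrite -[X in _ + X = _]tU' card_split ab.
Qed.

(** The walks of all sizes up to [n] are concatenated; a window of one of them remains an infix of
    the whole. *)
Lemma window_cover (col : 'I_n -> bool) :
  exists Z : seq 'I_n, size Z <= 5 * n ^ 2 /\
    forall S a b, is_match e col S a b ->
      exists s l, [/\ s + l <= size Z, l <= 5 * (a + b) &
                      is_match e col [set x in take l (drop s Z)] a b].
Proof.
suff cover_upto K : exists Z : seq 'I_n, size Z <= 5 * n * K /\
    forall S a b, a + b <= K -> is_match e col S a b ->
      exists U, [/\ infix U Z, size U <= 5 * (a + b) & is_match e col [set x in U] a b].
  have [Z [szZ cover]] := cover_upto n.
  exists Z; split=> [|S a b mS]; first by rewrite expnS expn1 mulnA.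
  have [|U [/infixP[A [B EZ]] szU mU]] := cover S a b _ mS.
    by case: mS => _ <- <-; rewrite card_split -[X in _ <= X](card_ord n) max_card.
  exists (size A), (size U); rewrite EZ !size_cat addnA leq_addr drop_size_cat //.
  by rewrite take_size_cat.
elim: K => [|K [Z [szZ cover]]].
  (* Size 0: the empty window represents the empty match of [(0, 0)]. *)
  exists [::]; rewrite muln0; split=> // S a b; rewrite leqn0 => /eqP ab [_ Sa Sb].
  have E : [set x : 'I_n in [::]] = set0 by apply/setP=> x; rewrite !inE.
  exists [::]; split=> //; split=> [x y||]; rewrite E ?inE //;
    (rewrite (_ : [set x in _ | _] = set0) ?cards0; last (by apply/setP=> x; rewrite !inE)); lia.
have [W [szW coverW]] := windows_of_size col K.
exists (Z ++ W); split=> [|S a b].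
  by rewrite size_cat mulnS addnC leq_add.
rewrite leq_eqVlt => /orP[/eqP ab|ab] mS.
  have [U [iU szU mU]] := coverW S a b ab mS.
  by exists U; split=> //; apply: infix_catl.
have [U [iU szU mU]] := cover S a b ab mS.
by exists U; split=> //; apply: infix_catr.
Qed.
End Walks.

(** * Execution rules for single instructions *)

Section Execution.
Variables (P : seq instr) (w : nat).
Implicit Types (p d s t f v l : nat) (r m : nat -> nat) (o out : seq nat).

Lemma run_const d k p f r m o out :
  nth IHalt P p = IConst d k -> p < size P -> k < 2 ^ w ->
  run P w f (State p.+1 (upd r d k) m o) = Some out ->
  run P w f.+1 (State p r m o) = Some out.
Proof. by move=> E lt_p lt_k; rewrite /= lt_p E modn_small. Qed.

Lemma run_bin v op d s t p f r m o out :
  nth IHalt P p = IBin op d s t -> p < size P ->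
  eval_binop op (r s) (r t) = v -> v < 2 ^ w ->
  run P w f (State p.+1 (upd r d v) m o) = Some out ->
  run P w f.+1 (State p r m o) = Some out.
Proof. by move=> E lt_p <- lt_v; rewrite /= lt_p E modn_small. Qed.

Lemma run_load v d s p f r m o out :
  nth IHalt P p = ILoad d s -> p < size P -> m (r s) = v ->
  run P w f (State p.+1 (upd r d v) m o) = Some out ->
  run P w f.+1 (State p r m o) = Some out.
Proof. by move=> E lt_p <-; rewrite /= lt_p E. Qed.

Lemma run_jz v s l p f r m o out :
  nth IHalt P p = IJz s l -> p < size P -> r s = v ->
  run P w f (State (if v == 0 then l else p.+1) r m o) = Some out ->
  run P w f.+1 (State p r m o) = Some out.
Proof. by move=> E lt_p <-; rewrite /= lt_p E. Qed.

Lemma run_jmp l p f r m o out :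
  nth IHalt P p = IJmp l -> p < size P ->
  run P w f (State l r m o) = Some out ->
  run P w f.+1 (State p r m o) = Some out.
Proof. by move=> E lt_p; rewrite /= lt_p E. Qed.

Lemma run_out v s p f r m o out :
  nth IHalt P p = IOut s -> p < size P -> r s = v ->
  run P w f (State p.+1 r m (v :: o)) = Some out ->
  run P w f.+1 (State p r m o) = Some out.
Proof. by move=> E lt_p <-; rewrite /= lt_p E. Qed.

Lemma run_halt p f r m o :
  nth IHalt P p = IHalt -> run P w f.+1 (State p r m o) = Some (rev o).
Proof. by move=> E /=; rewrite E if_same. Qed.

Lemma run_mono f f' st out :
  f <= f' -> run P w f st = Some out -> run P w f' st = Some out.
Proof.
elim: f f' st => [|f IH] [|f'] //= st le_f.
by case: (step P w st) => // st'; apply: IH.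
Qed.

End Execution.

Arguments run : simpl never.

(* The interior comments give the addresses of the jump targets.  Registers 0 and 1
   hold the Parikh vector, 2 stays 0, 3 holds [n], 4 holds 1 and 6 holds 5; in the loop
   at 22, registers 7 and 8 hold the ends of the window and 9 the current address.
   The code at 35 serves [n = 1], where words may have a single bit. *)
Definition enumerate_window : seq instr :=
  [:: ILoad 3 2; IConst 4 1; IBin OShr 5 3 4; IJz 5 35;
   IBin OLt 5 3 0; IJz 5 7; IJmp 33;
   (* 7 *) IBin OLt 5 3 1; IJz 5 10; IJmp 33;
   (* 10 *) IBin OAdd 5 3 4; IBin OMul 5 0 5; IBin OAdd 5 5 1; IConst 6 5;
   IBin OMul 5 5 6; IBin OAdd 5 5 4; ILoad 7 5; IJz 7 33;
   IBin OAdd 5 5 4; ILoad 8 5; IOut 4; IBin OAdd 9 7 2;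
   (* 22 *) IBin OEq 5 9 8; IJz 5 25; IHalt;
   (* 25 *) ILoad 10 9; IBin OAdd 5 9 4; ILoad 11 5; IBin OLt 5 11 7; IJz 5 31;
   IOut 10;
   (* 31 *) IBin OAdd 9 9 6; IJmp 22;
   (* 33 *) IOut 2; IHalt;
   (* 35 *) IBin OSub 5 4 3; IBin OEq 5 0 5; IBin OEq 7 1 3; IBin OMul 5 5 7;
   IJz 5 43; IOut 4; IOut 2; IHalt;
   (* 43 *) IJz 0 45; IJmp 33;
   (* 45 *) IJz 1 47; IJmp 33;
   (* 47 *) IOut 4; IHalt].

Lemma run_reject w f r m o : 2 <= f -> r 2 = 0 ->
  run enumerate_window w f (State 33 r m o) = Some (rev (0 :: o)).
Proof.
move=> le_f r2; apply: (run_mono le_f).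
by apply: (@run_out _ _ 0) => //; rewrite run_halt.
Qed.

(** * First occurrences and the scanning loop *)

Definition insert_new (o : seq nat) x := if x \in o then o else x :: o.
(** The latest new entry comes first, matching the reversed output of the machine. *)
Definition firsts s := foldl insert_new [::] s.

Lemma mem_firsts s : firsts s =i s.
Proof.
elim/last_ind: s => // s x IH y; rewrite /firsts -cats1 foldl_cat /= -/(firsts s) mem_cat inE orbC.
rewrite /insert_new; case: ifP => xs; rewrite ?inE IH //.
by case: (eqVneq y x) => [->|_] //; rewrite -IH xs.
Qed.

Lemma uniq_firsts s : uniq (firsts s).
Proof.
elim/last_ind: s => // s x IH; rewrite /firsts -cats1 foldl_cat /= -/(firsts s) /insert_new.
by case: ifP => //= ->.
Qed.

Definition window (z : nat -> nat) s l := [seq z i | i <- iota s l].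

(* The value is 0 when [z q] has no earlier occurrence; addresses of nodes are [3 %[mod 5]],
   hence positive. *)
Definition prev_addr (z : nat -> nat) q := \max_(p < q | z p == z q) (5 * p + 3).

(** The latest earlier occurrence decides: if it precedes [s], so do all others. One comparison with
    the start address thus detects a repeat inside the window. *)
Lemma prev_addr_lt z q s :
  s <= q -> (prev_addr z q < 5 * s + 3) = (z q \notin window z s (q - s)).
Proof.
move=> le_sq; rewrite addnS ltnS; apply/bigmax_leqP/negP.
  move=> H /mapP[p]; rewrite mem_iota subnKC // => /andP[sp pq] E.
  by have := H (Ordinal pq); rewrite /= -E eqxx => /(_ isT); lia.
move=> H p /eqP E; suff : p < s by lia.
rewrite ltnNge; apply/negP => sp; apply: H; apply/mapP; exists (val p) => //.
by rewrite mem_iota sp subnKC /=.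
Qed.

Lemma prev_addr_le z q : prev_addr z q <= 5 * q + 3.
Proof. by apply/bigmax_leqP => p _; move: (ltn_ord p); lia. Qed.

Section Loop.
Variables (w : nat) (m z : nat -> nat) (s l : nat).
Hypothesis z_mem : forall q, s <= q < s + l -> m (5 * q + 3) = z q.
Hypothesis prev_mem : forall q, s <= q < s + l -> m (5 * q + 4) = prev_addr z q.
Hypothesis big_w : 5 * (s + l) + 10 < 2 ^ w.

(** Invariant: after [j] entries the output is the flag 1 followed by the distinct nodes seen so
    far. A round costs at most ten instructions, the exit three. *)
Lemma run_loop rem j r : j + rem = l ->
  r 4 = 1 -> r 6 = 5 -> r 7 = 5 * s + 3 -> r 8 = 5 * (s + l) + 3 ->
  r 9 = 5 * (s + j) + 3 ->
  run enumerate_window w (10 * rem + 3)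
    (State 22 r m (firsts (window z s j) ++ [:: 1])) =
  Some (1 :: rev (firsts (window z s l))).
Proof.
elim: rem j r => [|rem IH] j r jl r4 r6 r7 r8 r9.
  apply: (@run_bin _ _ 1) => //; [by rewrite r8 r9 -jl addn0 /= eqxx | lia |].
  by apply: (@run_jz _ _ 1) => //; rewrite run_halt // rev_cat -jl addn0.
rewrite (_ : 10 * rem.+1 + 3 = 7 + (10 * rem + 3).+3); last lia.
have q_in : s <= s + j < s + l by lia.
apply: (@run_bin _ _ 0) => //; [by rewrite r8 r9 /= (_ : _ == _ = false) //; lia | lia |].
apply: (@run_jz _ _ 0) => //=.
apply: (@run_load _ _ (z (s + j))) => //.
  by rewrite /upd /= r9 z_mem.
apply: (@run_bin _ _ (5 * (s + j) + 4)) => //; [by rewrite /upd /= r9 r4; lia | lia |].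
apply: (@run_load _ _ (prev_addr z (s + j))) => //.
  by rewrite /upd /= prev_mem.
pose fresh := z (s + j) \notin firsts (window z s j).
apply: (@run_bin _ _ fresh) => //.
- by rewrite /upd /= r7 prev_addr_lt ?leq_addr // addKn /fresh mem_firsts.
- by case: fresh; lia.
have step_firsts : firsts (window z s j.+1) =
    if fresh then z (s + j) :: firsts (window z s j) else firsts (window z s j).
  rewrite /firsts /window -addn1 iotaD map_cat foldl_cat /= -/(window z s j).
  by rewrite -/(firsts _) /insert_new if_neg.
apply: (@run_jz _ _ fresh) => //.
(* Both branches continue here; the one that skips the output has one unit of fuel to spare. *)
have tail f r' : r' 4 = 1 -> r' 6 = 5 -> r' 7 = 5 * s + 3 ->
    r' 8 = 5 * (s + l) + 3 -> r' 9 = 5 * (s + j) + 3 -> 10 * rem + 5 <= f ->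
    run enumerate_window w f (State 31 r' m (firsts (window z s j.+1) ++ [:: 1])) =
    Some (1 :: rev (firsts (window z s l))).
  move=> r'4 r'6 r'7 r'8 r'9 le_f; apply: (run_mono le_f).
  rewrite (_ : 10 * rem + 5 = (10 * rem + 3).+2); last lia.
  apply: (@run_bin _ _ (5 * (s + j.+1) + 3)) => //; [by rewrite r'9 r'6 /=; lia | lia |].
  by apply: run_jmp => //; apply: IH => //; lia.
case: fresh step_firsts => /= E.
  by apply: (@run_out _ _ (z (s + j))) => //; rewrite -cat_cons -E; apply: tail => //; lia.
by rewrite -E; apply: tail => //; lia.
Qed.

End Loop.

(* The five arrays (the constant [n], the window starts, the window ends, the nodes, the
   previous occurrences) are interleaved modulo 5; the window of the Parikh vector [(a, b)]
   sits at position [a * n.+1 + b].  A start equal to 0 encodes the absence of a match. *)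
Definition cell n (tbl : nat -> nat -> option (nat * nat)) (z : nat -> nat) i :=
  let q := i %/ 5 in
  let entry := tbl (q %/ n.+1) (q %% n.+1) in
  match i %% 5 with
  | 0 => n
  | 1 => if entry is Some (s, l) then 5 * s + 3 else 0
  | 2 => if entry is Some (s, l) then 5 * (s + l) + 3 else 0
  | 3 => z q
  | _ => prev_addr z q
  end.

(** * Complete queries, for [n > 1] and for a single node *)

Section Query.
Variables (n w : nat) (tbl : nat -> nat -> option (nat * nat)) (z m : nat -> nat).
Hypothesis n_gt1 : 1 < n.
Hypothesis big_w : 256 * (n * n) < 2 ^ w.
Hypothesis tbl_bound : forall a b s l, tbl a b = Some (s, l) ->
  s + l <= 5 * (n * n) /\ l <= 5 * (a + b).
Hypothesis m_cell : forall i, i < 25 * (n * n) -> m i = cell n tbl z i.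

Lemma run_large a b : a < 2 ^ w -> b < 2 ^ w ->
  run enumerate_window w (50 * (a + b) + 50) (init_state a b m) =
  Some (if (a <= n) && (b <= n) then
          if tbl a b is Some (s, l) then 1 :: rev (firsts (window z s l)) else [:: 0]
        else [:: 0]).
Proof.
move=> lt_a lt_b.
have le_nn : 2 * n <= n * n by rewrite leq_mul2r n_gt1 orbT.
rewrite !addnS addn0 /init_state.
have m0 : m 0 = n by rewrite m_cell /cell ?mod0n //; lia.
apply: (@run_load _ _ n) => //.
apply: run_const => //; first lia.
apply: (@run_bin _ _ (n %/ 2)) => //.
  by apply: leq_ltn_trans (leq_div _ _) _; lia.
apply: (@run_jz _ _ (n %/ 2)) => //; rewrite (_ : _ == 0 = false); last lia.
apply: (@run_bin _ _ (n < a)) => //; first by case: leqP; lia.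
apply: (@run_jz _ _ (n < a)) => //; case: (leqP a n) => /= [le_a|_]; last first.
  by apply: run_jmp => //; apply: run_reject; rewrite // !addnS.
apply: (@run_bin _ _ (n < b)) => //; first by case: leqP; lia.
apply: (@run_jz _ _ (n < b)) => //; case: (leqP b n) => /= [le_b|_]; last first.
  by apply: run_jmp => //; apply: run_reject; rewrite // !addnS.
have le_an : a * n.+1 <= n * n + n by rewrite -mulnSr leq_mul2r le_a orbT.
(* The product is formed only after both comparisons with [n], so the position lies in the table and
   nothing overflows. *)
set q := a * n.+1 + b.
have lt_q : q < 5 * (n * n) by rewrite /q; lia.
have qa : q %/ n.+1 = a by rewrite /q divnMDl // divn_small ?addn0.
have qb : q %% n.+1 = b by rewrite /q modnMDl modn_small.
have div5 i : i < 5 -> (5 * q + i) %/ 5 = q.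
  by move=> lt_i; rewrite mulnC divnMDl // divn_small ?addn0.
have mod5 i : i < 5 -> (5 * q + i) %% 5 = i.
  by move=> lt_i; rewrite mulnC modnMDl modn_small.
have cell1 := m_cell (_ : 5 * q + 1 < _).
have cell2 := m_cell (_ : 5 * q + 2 < _).
rewrite /cell !div5 ?mod5 ?qa ?qb // in cell1 cell2.
apply: (@run_bin _ _ n.+1) => //; [by rewrite /upd /= addn1 | lia |].
apply: (@run_bin _ _ (a * n.+1)) => //; first lia.
apply: (@run_bin _ _ q) => //; first lia.
apply: run_const => //; first lia.
apply: (@run_bin _ _ (5 * q)) => //; [by rewrite /upd /= mulnC | lia |].
apply: (@run_bin _ _ (5 * q + 1)) => //; first lia.
case E : (tbl a b) cell1 cell2 => [[s l]|] cell1 cell2; last first.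
  (* Here [//] evaluates the remaining instructions. *)
  apply: (@run_load _ _ 0) => //; by rewrite /upd /= cell1 //; lia.
have [le_sl le_l] := tbl_bound E.
apply: (@run_load _ _ (5 * s + 3)) => //; first by rewrite /upd /= cell1 //; lia.
apply: (@run_jz _ _ (5 * s + 3)) => //; rewrite (_ : _ == 0 = false) /=; last lia.
apply: (@run_bin _ _ (5 * q + 2)) => //; [by rewrite /upd /= -addnA | lia |].
apply: (@run_load _ _ (5 * (s + l) + 3)) => //; first by rewrite /upd /= cell2 //; lia.
apply: (@run_out _ _ 1) => //.
apply: (@run_bin _ _ (5 * s + 3)) => //; [by rewrite /upd /= addn0 | lia |].
(* Ten instructions per entry and [l <= 5 * (a + b)] account for the factor 50. *)
apply: (@run_mono _ _ (10 * l + 3)); first lia.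
have cellE i k : k < 5 -> (5 * i + k) %/ 5 = i /\ (5 * i + k) %% 5 = k.
  by move=> lt_k; rewrite mulnC divnMDl // divn_small ?addn0 // modnMDl modn_small.
apply: (@run_loop _ _ _ s l _ _ _ l 0); rewrite ?addn0 //; last lia.
- move=> i i_in; rewrite m_cell; last lia.
  by rewrite /cell; have [// | -> ->] := cellE i 3.
- move=> i i_in; rewrite m_cell; last lia.
  by rewrite /cell; have [// | -> ->] := cellE i 4.
Qed.

End Query.

(** Cell 0 holds the colour of the only node; being at most 1 it shifts to 0, which selects the
    special branch. The output [[:: 1; 0]] is that node, [[:: 1]] the empty match. *)
Lemma run_single w (c : bool) (m : nat -> nat) a b :
  0 < w -> m 0 = c -> a < 2 ^ w -> b < 2 ^ w ->
  run enumerate_window w 20 (init_state a b m) =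
  Some (if (a == ~~ c) && (b == c) then [:: 1; 0]
        else if (a == 0) && (b == 0) then [:: 1] else [:: 0]).
Proof.
move=> w_gt0 m0 lt_a lt_b; rewrite /init_state.
have big_w : 1 < 2 ^ w by rewrite -{1}(expn0 2) ltn_exp2l.
have bit (x : bool) : x < 2 ^ w by apply: leq_ltn_trans big_w; case: x.
apply: (@run_load _ _ c) => //.
apply: run_const => //.
apply: (@run_bin _ _ 0) => //; [by rewrite /upd /=; case: (c) | exact: (bit false) |].
apply: (@run_jz _ _ 0) => //=.
apply: (@run_bin _ _ (~~ c)) => //; first by rewrite /upd /=; case: (c).
apply: (@run_bin _ _ (a == ~~ c)) => //.
apply: (@run_bin _ _ (b == c)) => //.
apply: (@run_bin _ _ ((a == ~~ c) && (b == c))) => //; first by rewrite /upd /= mulnb.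
apply: (@run_jz _ _ ((a == ~~ c) && (b == c))) => //.
case: (_ && _) => /=.
  apply: (@run_out _ _ 1) => //; apply: (@run_out _ _ 0) => //; exact: run_halt.
apply: (@run_jz _ _ a) => //; case: (a == 0) => /=; last by apply: run_jmp => //; apply: run_reject.
apply: (@run_jz _ _ b) => //; case: (b == 0) => /=; last by apply: run_jmp => //; apply: run_reject.
by apply: (@run_out _ _ 1) => //; exact: run_halt.
Qed.

(** * Construction and validity of the index *)

Section Index.
Variables (n : nat) (e : rel 'I_n) (col : 'I_n -> bool).

Lemma correct_output_match a b s :
  uniq s -> all (fun i => i < n) s ->
  is_match e col [set x : 'I_n | val x \in s] a b ->
  correct_output e col a b (1 :: s).
Proof.
move=> uniq_s lt_s ms; split=> [_|[]]; first by exists s.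
by exists [set x : 'I_n | val x \in s].
Qed.

Lemma correct_output_no_match a b :
  ~ (exists S, is_match e col S a b) -> correct_output e col a b [:: 0].
Proof. by move=> no_match; split. Qed.

Definition valid_index w (idx : seq nat) : Prop :=
  [/\ size idx <= 100 * n ^ 2,
      all (fun x => x < 2 ^ w) idx &
      forall (a b : nat) (m0 : nat -> nat),
        a < 2 ^ w -> b < 2 ^ w ->
        (forall i, m0 i < 2 ^ w) ->
        (forall i, i < size idx -> m0 i = nth 0 idx i) ->
        exists out,
          run enumerate_window w (100 * (a + b) + 100) (init_state a b m0) = Some out /\
          correct_output e col a b out].

Lemma valid_index_large w : 1 < n -> symmetric e -> (forall x y, connect e x y) ->
  256 * (n * n) < 2 ^ w -> exists idx, valid_index w idx.
Proof.
move=> n_gt1 sym_e conn_e big_w.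
have [Z [szZ cover]] := window_cover sym_e conn_e col.
pose z i := nth 0 [seq val x | x <- Z] i.
have windowE s l : s + l <= size Z -> window z s l = [seq val x | x <- take l (drop s Z)].
  move=> le_sl; rewrite /window /z map_take map_drop.
  by rewrite -(map_nth_iota 0) // size_map leq_subRL ?(leq_trans (leq_addr l s)) //.
pose entry_ok a b (o : option (nat * nat)) :=
  if o is Some (s, l)
  then [/\ s + l <= size Z, l <= 5 * (a + b) &
           is_match e col [set x in take l (drop s Z)] a b]
  else ~ exists S, is_match e col S a b.
(* Each entry is chosen nonconstructively; excluded middle on the existence of a match provides an
   admissible one. *)
pose tbl a b := epsilon (inhabits None) (entry_ok a b).
have tblP a b : entry_ok a b (tbl a b).
  apply: epsilon_spec; case: (classic (exists S, is_match e col S a b)) => [[S mS]|].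
    by have [s [l sl]] := cover S a b mS; exists (Some (s, l)).
  by exists None.
have tbl_bound a b s l : tbl a b = Some (s, l) ->
    s + l <= 5 * (n * n) /\ l <= 5 * (a + b).
  move=> E; have := tblP a b; rewrite E => -[le_sl le_l _]; split=> //.
  by rewrite mulnn (leq_trans le_sl).
have lt_z i : z i < n.
  (* Beyond the end of [Z] the default 0 is still below [n]. *)
  case: (ltnP i (size Z)) => lt_i; last by rewrite /z nth_default ?size_map //; lia.
  have /mapP[x _ ->] : z i \in [seq val x | x <- Z] by rewrite mem_nth ?size_map.
  exact: ltn_ord.
(* Five interleaved arrays of [5 * (n * n)] positions, enough for both [Z] and the table. *)
exists (mkseq (cell n tbl z) (25 * (n * n))); split.
- by rewrite size_mkseq -mulnn leq_mul2r orbT.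
- apply/allP => x /mapP[i]; rewrite mem_iota add0n => /andP[_ lt_i] ->.
  have lt_q : i %/ 5 < 5 * (n * n) by rewrite ltn_divLR //; lia.
  have le_n : n <= n * n by rewrite leq_pmulr //; lia.
  rewrite /cell; move: (i %/ 5) lt_q => q lt_q.
  have entry_lt k : (forall s l, s + l <= 5 * (n * n) -> k s l <= 25 * (n * n) + 3) ->
      (if tbl (q %/ n.+1) (q %% n.+1) is Some (s, l) then k s l else 0) < 2 ^ w.
    case E: (tbl _ _) => [[s l]|] le_k; last by lia.
    by have := le_k s l (proj1 (tbl_bound _ _ _ _ E)); lia.
  case: (i %% 5) => [|[|[|[|_]]]].
  + lia.
  + by apply: entry_lt => s l; lia.
  + by apply: entry_lt => s l; lia.
  + by have := lt_z q; lia.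
  + by have := prev_addr_le z q; lia.
move=> a b m lt_a lt_b _ mE; eexists; split.
  apply: (@run_mono _ _ (50 * (a + b) + 50)); first lia.
  apply: (run_large n_gt1 big_w tbl_bound) => // i lt_i.
  by rewrite mE ?size_mkseq // nth_mkseq.
have too_big : ~~ ((a <= n) && (b <= n)) -> ~ exists S, is_match e col S a b.
  move=> /negP big [S [_ Sa Sb]]; apply: big.
  have card_le (A : {set 'I_n}) : #|A| <= n by rewrite -[X in _ <= X](card_ord n) max_card.
  by rewrite -Sa -Sb !card_le.
case: ifP => [_|/negbT/too_big]; last exact: correct_output_no_match.
have := tblP a b; case: (tbl a b) => [[s l]|] /=; last exact: correct_output_no_match.
case=> le_sl _ mS; have mem_out : rev (firsts (window z s l)) =i window z s l.
  by move=> i; rewrite mem_rev mem_firsts.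
apply: correct_output_match.
- by rewrite rev_uniq uniq_firsts.
- by apply/allP=> i; rewrite mem_out => /mapP[q _ ->].
congr (is_match _ _ _ _ _): mS; apply/setP=> x.
by rewrite !inE mem_out windowE // mem_map //; exact: val_inj.
Qed.

End Index.

Lemma valid_index_single (e : rel 'I_1) col w :
  0 < w -> valid_index e col w [:: nat_of_bool (col ord0)].
Proof.
move=> w_gt0; set c := col ord0.
have big_w : 1 < 2 ^ w by rewrite -{1}(expn0 2) ltn_exp2l.
split=> //=; first by rewrite andbT; apply: leq_ltn_trans big_w; case: c.
move=> a b m lt_a lt_b _ mE; eexists; split.
  apply: (@run_mono _ _ 20); first lia.
  by apply: (@run_single _ c) => //; rewrite mE.
have card1 (S : {set 'I_1}) p : #|[set x in S | p x]| = (ord0 \in S) && p ord0.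
  rewrite (_ : [set x in S | p x] = if (ord0 \in S) && p ord0 then setT else set0).
    by case: ifP; rewrite ?cardsT ?card_ord ?cards0.
  by apply/setP=> x; rewrite (ord1 x) !inE; case: ifP; rewrite inE.
have matchE S : is_match e col S a b <->
    a = ((ord0 \in S) && ~~ c) /\ b = ((ord0 \in S) && c).
  rewrite /is_match !card1; split=> [[_ -> ->] //|[-> ->]]; split=> // x y _ _.
  by rewrite (ord1 x) (ord1 y).
case: ifP => [/andP[/eqP Ea /eqP Eb]|no1].
  apply: correct_output_match => //; apply/matchE.
  by rewrite !inE Ea Eb.
case: ifP => [/andP[/eqP Ea /eqP Eb]|no0].
  apply: correct_output_match => //; apply/matchE.
  by rewrite !inE Ea Eb.
apply: correct_output_no_match => -[S /matchE[Ea Eb]].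
by move: no1 no0; rewrite Ea Eb; case: (ord0 \in S); rewrite //= !eqxx.
Qed.

Lemma valid_index_exists n (e : rel 'I_n) (col : 'I_n -> bool) w :
  is_tree e -> n ^ 10 < 2 ^ w -> exists idx, valid_index e col w idx.
Proof.
case=> n_gt0 sym_e _ conn_e _ big_w.
case: (ltnP 1 n) => [n_gt1|n_le1].
  apply: valid_index_large => //; apply: leq_ltn_trans big_w.
  (* From [n >= 2], [256 = 2 ^ 8 <= n ^ 8]; with the factor [n * n] this explains the exponent
     10. *)
  rewrite (expnD n 8 2) -mulnn; apply: leq_mul => //.
  by rewrite -[256]/(2 ^ 8) leq_exp2r.
have E : n = 1 by apply/eqP; rewrite eqn_leq n_le1.
subst n; exists [:: nat_of_bool (col ord0)]; apply: valid_index_single.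
by case: w big_w.
Qed.

Theorem theorem2 :
  exists (P : seq instr) (c C : nat)
         (index : forall n : nat, rel 'I_n -> ('I_n -> bool) -> nat -> seq nat),
  forall (n : nat) (e : rel 'I_n) (col : 'I_n -> bool) (w : nat),
    is_tree e -> n ^ c < 2 ^ w ->
    [/\ size (index n e col w) <= C * n ^ 2,
        all (fun x => x < 2 ^ w) (index n e col w) &
        forall (a b : nat) (m0 : nat -> nat),
          a < 2 ^ w -> b < 2 ^ w ->
          (forall i, m0 i < 2 ^ w) ->
          (forall i, i < size (index n e col w) -> m0 i = nth 0 (index n e col w) i) ->
          exists out,
            run P w (C * (a + b) + C) (init_state a b m0) = Some out /\
            correct_output e col a b out].
Proof.
exists enumerate_window, 10, 100.
exists (fun n e col w => epsilon (inhabits [::]) (@valid_index n e col w)).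
move=> n e col w tree_e big_w.
exact: epsilon_spec (valid_index_exists col tree_e big_w).
Qed.
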